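(* Let $k$ be a commutative ring and let $F:\mathcal{C}\to\mathcal{B}$ be a Galois covering of $k$-categories. Then there exists a unique isomorphism of categories $F':\mathcal{C}/\mathrm{Aut}_1(F)\to\mathcal{B}$ such that $F'P=F$, where $P:\mathcal{C}\to\mathcal{C}/\mathrm{Aut}_1(F)$ is the Galois covering given by the categorical quotient.
   Context: A $k$-category is a small category $\mathcal{B}$ with object set $\mathcal{B}_0$, in which each morphism set ${}_y\mathcal{B}_x$ from $x$ to $y$ is a $k$-module, composition is $k$-bilinear, and $k$-multiples of the identity at each object are central in its endomorphism ring. A $k$-functor is a functor that is $k$-linear on morphisms; isomorphisms of $k$-categories are understood to be $k$-functors. The star at an object $b_0$ is $\mathrm{St}_{b_0}\mathcal{B}=\left(\bigoplus_{y\in\mathcal{B}_0}{}_y\mathcal{B}_{b_0}\right)\oplus\left(\bigoplus_{y\in\mathcal{B}_0}{}_{b_0}\mathcal{B}_y\right)$. A $k$-functor $F:\mathcal{C}\to\mathcal{B}$ is a covering if it is surjective on objects and, for each $b_0\in\mathcal{B}_0$ and each $x\in F^{-1}(b_0)$, the map $\mathrm{St}_x\mathcal{C}\to\mathrm{St}_{b_0}\mathcal{B}$ induced by $F$ is an isomorphism of $k$-modules. A $k$-category $\mathcal{B}$ is connected if for any two objects $b,c$ there is a finite sequence of objects $b=x_1,\dots,x_n=c$ such that for each $1\le i<n$ there is a non-zero morphism in ${}_{x_{i+1}}\mathcal{B}_{x_i}$ or in ${}_{x_i}\mathcal{B}_{x_{i+1}}$. For a covering $F:\mathcal{C}\to\mathcal{B}$,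 $\mathrm{Aut}_1(F)$ is the group of pairs $(H,1)$ with $H$ an automorphism of the $k$-category $\mathcal{C}$ such that $FH=F$. A covering $F:\mathcal{C}\to\mathcal{B}$ is a Galois covering if $\mathcal{C}$ is connected and $\mathrm{Aut}_1(F)$ acts transitively on some fibre $F^{-1}(b)$. (When $\mathcal{C}$ is connected, $\mathrm{Aut}_1(F)$ acts freely on the objects of $\mathcal{C}$.) If a group $G$ acts by $k$-linear automorphisms on $\mathcal{C}$, freely on objects, the categorical quotient $\mathcal{C}/G$ is the $k$-category whose objects are the $G$-orbits of $\mathcal{C}_0$ and whose morphisms from an orbit $\alpha$ to an orbit $\beta$ are ${}_\beta(\mathcal{C}/G)_\alpha=\left(\bigoplus_{x\in\alpha,\,y\in\beta}{}_y\mathcal{C}_x\right)/G$, where for a $kG$-module $X$, $X/G$ denotes the module of coinvariants (quotient of $X$ by $(\ker\epsilon)X$, with $\epsilon:kG\to k$ the augmentation). Composition is induced from $\mathcal{C}$: for $f\in{}_y\mathcal{C}_x$, $g\in{}_z\mathcal{C}_{y'}$ with $y,y'$ in the same orbit, $[g][f]=[(sg)f]$ where $s\in G$ is the unique element with $sy'=y$. The projection functor $P$ sends an object to its orbit and a morphism to its class. *)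

(* Defs.v *)
From HB Require Import structures.
From mathcomp Require Import all_boot all_order ssralg generic_quotient.
From mathcomp Require Import boolp classical_sets functions cardinality fsbigop.

Set Implicit Arguments.
Unset Strict Implicit.
Unset Printing Implicit Defensive.

Import GRing.Theory.
Local Open Scope classical_set_scope.
Local Open Scope ring_scope.

Section LinearFacts.
Variables (k : comPzRingType) (U V : lmodType k) (f : U -> V).
Hypothesis lf : linear f.

Let flin := GRing.isLinear.Build k U V *:%R f lf.
HB.instance Definition _ := flin.
Lemma lin0 : f 0 = 0. Proof. exact: linear0. Qed.
Lemma linD : {morph f : x y / x + y}. Proof. exact: linearD. Qed.
Lemma linZ : scalable f. Proof. exact: linearZ_LR. Qed.
End LinearFacts.

Section DirectSum.
Variables (k : comPzRingType) (I : Type) (M : I -> lmodType k).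

Record dsum := DSum {
  dval :> forall i, M i;
  dfin : finite_set [set i | dval i <> 0] }.

Lemma dsum_eq (u v : dsum) : (forall i, u i = v i) -> u = v.
Proof.
case: u v => u fu [v fv] /= uv; have {}uv : u = v by apply: functional_extensionality_dep.
by case: v / uv fv => fv; congr DSum; apply: Prop_irrelevance.
Qed.

HB.instance Definition _ := gen_eqMixin dsum.
HB.instance Definition _ := gen_choiceMixin dsum.

Fact dsum0_fin : finite_set [set i | (0 : M i) <> 0].
Proof. by apply: (sub_finite_set _ (finite_set0 I)) => i. Qed.
Definition dsum0 := DSum dsum0_fin.

Fact dsumN_fin (u : dsum) : finite_set [set i | - u i <> 0].
Proof. by apply: (sub_finite_set _ (dfin u)) => i /= + ui0; rewrite ui0 oppr0. Qed.
Definition dsumN u := DSum (dsumN_fin u).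

Fact dsumD_fin (u v : dsum) : finite_set [set i | u i + v i <> 0].
Proof.
have fuv : finite_set ([set i | u i <> 0] `|` [set i | v i <> 0]).
  by rewrite finite_setU; split; apply: dfin.
apply: (sub_finite_set _ fuv) => i /= uv0; apply: contrapT => /not_orP[].
by move=> /contrapT u0 /contrapT v0; apply: uv0; rewrite u0 v0 addr0.
Qed.
Definition dsumD u v := DSum (dsumD_fin u v).

Fact dsumZ_fin (a : k) (u : dsum) : finite_set [set i | a *: u i <> 0].
Proof. by apply: (sub_finite_set _ (dfin u)) => i /= + ui0; rewrite ui0 scaler0. Qed.
Definition dsumZ a u := DSum (dsumZ_fin a u).

Fact dsumDA : associative dsumD.
Proof. by move=> u v w; apply: dsum_eq => i /=; rewrite addrA. Qed.
Fact dsumDC : commutative dsumD.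
Proof. by move=> u v; apply: dsum_eq => i /=; rewrite addrC. Qed.
Fact dsum0D : left_id dsum0 dsumD.
Proof. by move=> u; apply: dsum_eq => i /=; rewrite add0r. Qed.
Fact dsumND : left_inverse dsum0 dsumN dsumD.
Proof. by move=> u; apply: dsum_eq => i /=; rewrite addNr. Qed.

HB.instance Definition _ :=
  GRing.isZmodule.Build dsum dsumDA dsumDC dsum0D dsumND.

Fact dsumZA a b u : dsumZ a (dsumZ b u) = dsumZ (a * b) u.
Proof. by apply: dsum_eq => i /=; rewrite scalerA. Qed.
Fact dsum1Z : left_id 1 dsumZ.
Proof. by move=> u; apply: dsum_eq => i /=; rewrite scale1r. Qed.
Fact dsumZDr : right_distributive dsumZ +%R.
Proof. by move=> a u v; apply: dsum_eq => i /=; rewrite scalerDr. Qed.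
Fact dsumZDl u : {morph dsumZ^~ u : a b / a + b}.
Proof. by move=> a b; apply: dsum_eq => i /=; rewrite scalerDl. Qed.

HB.instance Definition _ :=
  GRing.Zmodule_isLmodule.Build k dsum dsumZA dsum1Z dsumZDr dsumZDl.

Lemma dsum0E i : (0 : dsum) i = 0. Proof. by []. Qed.
Lemma dsumDE (u v : dsum) i : (u + v) i = u i + v i. Proof. by []. Qed.
Lemma dsumNE (u : dsum) i : (- u) i = - u i. Proof. by []. Qed.
Lemma dsumZE a (u : dsum) i : (a *: u) i = a *: u i. Proof. by []. Qed.

Definition dinj_fun i (x : M i) j : M j :=
  match pselect (i = j) with
  | left e => ecast j' (M j') e x
  | right _ => 0
  end.

Fact dinj_fin i (x : M i) : finite_set [set j | dinj_fun x j <> 0].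
Proof.
apply: (sub_finite_set _ (finite_set1 i)) => j /=.
by rewrite /dinj_fun; case: pselect.
Qed.

Definition dinj i (x : M i) : dsum := DSum (dinj_fin x).

Lemma dinjE i (x : M i) : dinj x i = x.
Proof. by rewrite /= /dinj_fun; case: pselect => // e; rewrite (Prop_irrelevance e erefl). Qed.

Lemma dinj_neq i (x : M i) j : i <> j -> dinj x j = 0.
Proof. by rewrite /= /dinj_fun; case: pselect. Qed.

Lemma dinj_linear i : linear (@dinj i).
Proof.
move=> a x y; apply: dsum_eq => j; rewrite dsumDE dsumZE.
have [<-|/[dup]ij] := pselect (i = j); first by rewrite !dinjE.
by move=> /dinj_neq ij0; rewrite !ij0 scaler0 addr0.
Qed.

Lemma dinj_cast i j (e : i = j) (x : M i) : dinj (ecast j' (M j') e x) = dinj x.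
Proof. by case: j / e. Qed.

Lemma dsum_ind (P : dsum -> Prop) :
  P 0 -> (forall i (x : M i) u, P u -> P (dinj x + u)) -> forall u, P u.
Proof.
move=> P0 PD u.
have /(finite_seqP (T := {classic I}))[s us] := dfin u.
have {us} : forall i : {classic I}, u i <> 0 -> i \in s.
  by move=> i ui0; have : [set` s] i by rewrite -us.
elim: s u => [|i s IHs] u us.
  suff -> : u = 0 by [].
  by apply: dsum_eq => i; apply: contrapT => /us.
rewrite -[u](subrKC (dinj (u i))); apply/PD/IHs => j.
rewrite dsumDE dsumNE; have [<-|ij] := pselect (i = j :> I).
  by rewrite dinjE subrr.
rewrite (dinj_neq _ ij) subr0 => /us; rewrite inE => /orP[/eqP ji|//].
by case: ij.
Qed.

Definition dlift (N : lmodType k) (phi : forall i, M i -> N) (u : dsum) : N :=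
  \sum_(i \in [set: {classic I}]) phi i (u i).

Section Lift.
Variables (N : lmodType k) (phi : forall i, M i -> N).
Hypothesis phi_lin : forall i, linear (@phi i).

Lemma dlift_linear : linear (dlift phi).
Proof.
move=> a u v.
have fA : finite_set ([set i : {classic I} | u i <> 0] `|` [set i | v i <> 0]).
  by rewrite finite_setU; split; apply: dfin.
have E (w : dsum) : (forall i, u i = 0 -> v i = 0 -> w i = 0) ->
    dlift phi w = \sum_(i \in [set i : {classic I} | u i <> 0] `|`
                     [set i | v i <> 0]) phi (w i).
  move=> w0; rewrite /dlift; apply/esym/fsbig_widen => // i [_ /= /not_orP[]].
  move=> /contrapT ui /contrapT vi.
  by rewrite (w0 i ui vi) (lin0 (@phi_lin i)).
rewrite !E //; last by move=> i /= -> ->; rewrite scaler0 addr0.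
rewrite !fsbig_finite// scaler_sumr -big_split.
by apply: eq_bigr => i _; rewrite dsumDE dsumZE phi_lin.
Qed.

Lemma dlift_inj i (x : M i) : dlift phi (dinj x) = phi x.
Proof.
rewrite /dlift -(@fsbig_widen {classic I} _ _ _ [set (i : {classic I})]) //.
  by rewrite fsbig_set1 dinjE.
move=> j [_ ji]; change (phi (dinj x j) = 0).
by rewrite dinj_neq ?(lin0 (@phi_lin j))// => /esym.
Qed.

Lemma dlift_ext (f : dsum -> N) : linear f ->
  (forall i (x : M i), f (dinj x) = phi x) -> dlift phi =1 f.
Proof.
move=> flin fphi u; elim/dsum_ind: u => [|i x u IHu].
  by rewrite (lin0 dlift_linear) (lin0 flin).
by rewrite (linD dlift_linear) (linD flin) dlift_inj fphi IHu.
Qed.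

End Lift.

End DirectSum.

Arguments dinj {k I M} i x : simpl never.
Arguments dlift {k I M N} phi u : simpl never.

Section QuotientModule.
Local Open Scope quotient_scope.
Variables (k : comPzRingType) (V : lmodType k) (S : submodClosed V).

Fact submod_rpredN x : (- x \in S) = (x \in S).
Proof. by apply/idP/idP => /(rpredZ (-1)); rewrite scaleN1r ?opprK. Qed.

Definition qequiv (x y : V) : bool := x - y \in S.

Fact qequiv_refl : reflexive qequiv.
Proof. by move=> x; rewrite /qequiv subrr rpred0. Qed.
Fact qequiv_sym : symmetric qequiv.
Proof. by move=> x y; rewrite /qequiv -opprB submod_rpredN. Qed.
Fact qequiv_trans : transitive qequiv.
Proof.
by move=> y x z xy yz; rewrite /qequiv -[x](subrK y) -addrA rpredD.
Qed.

Canonical qequiv_rel := EquivRel qequiv qequiv_refl qequiv_sym qequiv_trans.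

Definition quotmod := {eq_quot qequiv_rel}.

HB.instance Definition _ := Choice.on quotmod.

Definition qpi (x : V) : quotmod := \pi_(quotmod) x.

Lemma qpi_surj (q : quotmod) : qpi (repr q) = q.
Proof. exact: reprK. Qed.

Lemma qpi_eq x y : qpi x = qpi y <-> x - y \in S.
Proof. by split=> [/eqmodP|xy]; last apply/eqmodP. Qed.

Definition qzero : quotmod := qpi 0.
Definition qopp (q : quotmod) : quotmod := qpi (- repr q).
Definition qadd (q r : quotmod) : quotmod := qpi (repr q + repr r).
Definition qscale (a : k) (q : quotmod) : quotmod := qpi (a *: repr q).

Fact qpiN x : qpi (- x) = qopp (qpi x).
Proof.
apply/qpi_eq; rewrite -opprD submod_rpredN.
by apply/qpi_eq; rewrite qpi_surj.
Qed.
Fact qpiD x y : qpi (x + y) = qadd (qpi x) (qpi y).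
Proof.
apply/qpi_eq; rewrite opprD addrACA.
by apply: rpredD; apply/qpi_eq; rewrite qpi_surj.
Qed.
Fact qpiZ a x : qpi (a *: x) = qscale a (qpi x).
Proof.
apply/qpi_eq; rewrite -scalerBr.
by apply: rpredZ; apply/qpi_eq; rewrite qpi_surj.
Qed.

Fact qaddA : associative qadd.
Proof.
move=> p q r; rewrite -(qpi_surj p) -(qpi_surj q) -(qpi_surj r).
by rewrite -!qpiD addrA.
Qed.
Fact qaddC : commutative qadd.
Proof. by move=> p q; rewrite /qadd addrC. Qed.
Fact qadd0 : left_id qzero qadd.
Proof. by move=> p; rewrite -(qpi_surj p) -qpiD add0r. Qed.
Fact qaddN : left_inverse qzero qopp qadd.
Proof. by move=> p; rewrite -(qpi_surj p) -qpiN -qpiD addNr. Qed.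

HB.instance Definition _ :=
  GRing.isZmodule.Build quotmod qaddA qaddC qadd0 qaddN.

Fact qpi_add : {morph qpi : x y / x + y}.
Proof. exact: qpiD. Qed.

Fact qscaleA a b q : qscale a (qscale b q) = qscale (a * b) q.
Proof. by rewrite -(qpi_surj q) -!qpiZ scalerA. Qed.
Fact qscale1 : left_id 1 qscale.
Proof. by move=> q; rewrite -(qpi_surj q) -qpiZ scale1r. Qed.
Fact qscaleDr : right_distributive qscale +%R.
Proof.
move=> a p q; rewrite -(qpi_surj p) -(qpi_surj q).
by rewrite -qpi_add -!qpiZ -qpi_add scalerDr.
Qed.
Fact qscaleDl q : {morph qscale^~ q : a b / a + b}.
Proof. by move=> a b; rewrite -(qpi_surj q) -!qpiZ -qpi_add scalerDl. Qed.

HB.instance Definition _ :=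
  GRing.Zmodule_isLmodule.Build k quotmod qscaleA qscale1 qscaleDr qscaleDl.

Lemma qpi_linear : linear qpi.
Proof. by move=> a x y; rewrite qpi_add qpiZ. Qed.

End QuotientModule.

Section Coinvariants.
Variables (k : comPzRingType) (G : groupType).

Definition group_alg : lmodType k := dsum (fun _ : G => k^o : lmodType k).

Definition augmentation : group_alg -> k^o := dlift (fun (_ : G) (a : k^o) => a).

Variables (X : lmodType k) (act : G -> X -> X).

Definition galg_act (u : group_alg) (x : X) : X :=
  dlift (fun (g : G) (a : k^o) => (a : k) *: act g x) u.

(* The submodule $(\ker\epsilon)X$. *)
Definition aug_sub : {pred X} := fun z =>
  `[< exists2 s : seq (group_alg * X),
        forall p, p \in s -> augmentation p.1 = 0 &
        z = \sum_(p <- s) galg_act p.1 p.2 >].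

Fact augmentation_linear : linear augmentation.
Proof. by apply: dlift_linear => g a x y. Qed.

Fact galg_act_linear x : linear (galg_act^~ x).
Proof. by apply: dlift_linear => g a u v; rewrite scalerDl scalerA. Qed.

Fact aug_sub_submod : submod_closed aug_sub.
Proof.
split; first by apply/asboolP; exists [::]; rewrite ?big_nil.
move=> a _ _ /asboolP[s s0 ->] /asboolP[t t0 ->]; apply/asboolP.
exists ([seq (a *: p.1, p.2) | p <- s] ++ t) => [p|].
  rewrite mem_cat => /orP[/mapP[q qs ->]|/t0//] /=.
  by rewrite (linZ augmentation_linear) s0// scaler0.
rewrite big_cat big_map /= scaler_sumr; congr (_ + _).
by apply: eq_bigr => p _; rewrite (linZ (galg_act_linear _)).
Qed.

HB.instance Definition _ := GRing.isSubmodClosed.Build k X aug_sub aug_sub_submod.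

Definition coinv : lmodType k := quotmod aug_sub.

Definition coinv_pi : X -> coinv := @qpi k X aug_sub.

Lemma coinv_pi_linear : linear coinv_pi.
Proof. exact: qpi_linear. Qed.

Lemma coinv_piP x y : coinv_pi x = coinv_pi y <-> x - y \in aug_sub.
Proof. exact: qpi_eq. Qed.

Lemma coinv_pi_surj (q : coinv) : exists x, coinv_pi x = q.
Proof. by exists (repr q); apply: qpi_surj. Qed.

Lemma coinv_pi_act g x : (forall y, act 1%g y = y) ->
  coinv_pi (act g x) = coinv_pi x.
Proof.
move=> act1; apply/coinv_piP/asboolP.
pose u : group_alg := -1 *: dinj 1%g (1 : k^o) + dinj g (1 : k^o).
exists [:: (u, x)] => [p|].
  rewrite inE => /eqP-> /=; rewrite augmentation_linear /augmentation.
  by rewrite !dlift_inj ?scaleN1r ?addNr.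
have glin h : linear (fun a : k^o => (a : k) *: act h x).
  by move=> a v w; rewrite scalerDl scalerA.
rewrite big_seq1 /= [galg_act u x](galg_act_linear x) /galg_act !dlift_inj //.
by rewrite !scale1r scaleN1r addrC act1.
Qed.

Lemma aug_sub_kill (N : lmodType k) (f : X -> N) : linear f ->
  (forall g x, f (act g x) = f x) -> forall z, z \in aug_sub -> f z = 0.
Proof.
move=> flin fact z /asboolP[s s0 ->].
elim: s s0 => [|p s IHs] s0; first by rewrite big_nil (lin0 flin).
rewrite big_cons (linD flin) IHs ?addr0; last first.
  by move=> q qs; apply: s0; rewrite inE qs orbT.
have -> : f (galg_act p.1 p.2) = (augmentation p.1 : k) *: f p.2.
  elim/dsum_ind: p.1 => [|g a u IHu].
    by rewrite (lin0 (galg_act_linear _)) (lin0 augmentation_linear) scale0r (lin0 flin).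
  rewrite (linD (galg_act_linear _)) (linD augmentation_linear) (linD flin) IHu.
  rewrite scalerDl; congr (_ + _).
  rewrite /galg_act /augmentation !dlift_inj ?(linZ flin) ?fact//.
  by move=> h b v w; rewrite scalerDl scalerA.
by rewrite s0 ?scale0r// inE eqxx.
Qed.

End Coinvariants.

(* [hom x y] is the k-module ${}_y\mathcal{B}_x$ of morphisms from x to y, and
   [comp g f] is the composite gf.  That k-multiples of identities are central
   in endomorphism rings is a consequence of bilinearity: see [idmZ_central]. *)
Record kcat (k : comPzRingType) := KCat {
  ob :> Type;
  hom : ob -> ob -> lmodType k;
  idm : forall x, hom x x;
  comp : forall x y z, hom y z -> hom x y -> hom x z;
  comp_linl : forall x y z (f : hom x y), linear (fun g : hom y z => comp g f);
  comp_linr : forall x y z (g : hom y z), linear (fun f : hom x y => comp g f);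
  comp_idl : forall x y (f : hom x y), comp (idm y) f = f;
  comp_idr : forall x y (f : hom x y), comp f (idm x) = f;
  compA : forall x y z w (h : hom z w) (g : hom y z) (f : hom x y),
    comp h (comp g f) = comp (comp h g) f }.

Arguments hom {k C} x y : rename.
Arguments idm {k C} x : rename.
Arguments comp {k C x y z} g f : rename.

Section Categories.
Variable k : comPzRingType.
Implicit Types B C D : kcat k.

Lemma idmZ_central C (x : C) (a : k) (f : hom x x) :
  comp (a *: idm x) f = comp f (a *: idm x).
Proof.
by rewrite (linZ (comp_linl f)) (linZ (comp_linr f)) comp_idl comp_idr.
Qed.

Definition hcast C (x x' y y' : C) (ex : x = x') (ey : y = y') (f : hom x y) :
    hom x' y' :=
  ecast v (hom x' v) ey (ecast u (hom u y) ex f).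

Lemma hcast_id C (x y : C) (ex : x = x) (ey : y = y) (f : hom x y) :
  hcast ex ey f = f.
Proof. by rewrite (Prop_irrelevance ex erefl) (Prop_irrelevance ey erefl). Qed.

Record kfunctor C D := KFunctor {
  fob :> C -> D;
  fhom : forall x y : C, hom x y -> hom (fob x) (fob y);
  fhom_lin : forall x y : C, linear (@fhom x y);
  fhom_id : forall x : C, fhom (idm x) = idm (fob x);
  fhom_comp : forall (x y z : C) (g : hom y z) (f : hom x y),
    fhom (comp g f) = comp (fhom g) (fhom f) }.

Lemma kfunctor_eqP C D (F F' : kfunctor C D) :
  F = F' <-> exists e : forall x, F x = F' x,
    forall (x y : C) (f : hom x y), hcast (e x) (e y) (fhom F f) = fhom F' f.
Proof.
split=> [<-|]; first by exists (fun=> erefl).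
case: F F' => [F0 F1 Fl Fi Fc] [F0' F1' Fl' Fi' Fc'] /= [e].
have E : F0 = F0' by apply/funext.
case: F0' / E F1' Fl' Fi' Fc' e => F1' Fl' Fi' Fc' e He.
have E : F1 = F1'.
  apply/functional_extensionality_dep => x; apply/functional_extensionality_dep => y.
  by apply/funext => f; rewrite -He hcast_id.
case: F1' / E Fl' Fi' Fc' He => Fl' Fi' Fc' _.
by congr KFunctor; apply: Prop_irrelevance.
Qed.

Definition kid C : kfunctor C C.
Proof. by exists (fun x => x) (fun _ _ f => f). Defined.

Definition kcomp C D E (G : kfunctor D E) (F : kfunctor C D) : kfunctor C E.
Proof.
exists (fun x => G (F x)) (fun x y f => fhom G (fhom F f)).
- by move=> x y a f g; rewrite !fhom_lin.
- by move=> x; rewrite !fhom_id.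
- by move=> x y z g f; rewrite !fhom_comp.
Defined.

Lemma kcompA C D E E' (H : kfunctor E E') (G : kfunctor D E) (F : kfunctor C D) :
  kcomp H (kcomp G F) = kcomp (kcomp H G) F.
Proof. by apply/kfunctor_eqP; exists (fun=> erefl). Qed.

Lemma kcomp1f C D (F : kfunctor C D) : kcomp (kid D) F = F.
Proof. by apply/kfunctor_eqP; exists (fun=> erefl). Qed.

Lemma kcompf1 C D (F : kfunctor C D) : kcomp F (kid C) = F.
Proof. by apply/kfunctor_eqP; exists (fun=> erefl). Qed.

Definition is_kiso C D (F : kfunctor C D) : Prop :=
  exists G : kfunctor D C, kcomp G F = kid C /\ kcomp F G = kid D.

Definition star B (b : B) : lmodType k :=
  (dsum (fun y : B => hom b y) * dsum (fun y : B => hom y b))%type.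

(* For x in the fibre of b, the target star is the one at b = F x. *)
Definition star_map C B (F : kfunctor C B) (x : C) (u : star x) : star (F x) :=
  (dlift (fun (y : C) (f : hom x y) =>
     dinj (M := fun b : B => hom (F x) b) (F y) (fhom F f)) u.1,
   dlift (fun (y : C) (f : hom y x) =>
     dinj (M := fun b : B => hom b (F x)) (F y) (fhom F f)) u.2).

Lemma star_map_linear C B (F : kfunctor C B) (x : C) : linear (star_map F (x := x)).
Proof.
move=> a u v; congr pair; apply: dlift_linear => y b f g;
  by rewrite fhom_lin dinj_linear.
Qed.

Definition is_covering C B (F : kfunctor C B) : Prop :=
  (forall b : B, exists x : C, F x = b) /\
  (forall x : C, bijective (star_map F (x := x))).

Definition is_connected C : Prop :=
  forall b c : C, exists (n : nat) (x : nat -> C),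
    [/\ x 0%N = b, x n = c & forall i, (i < n)%N ->
      (exists f : hom (x i) (x i.+1), f <> 0) \/
      (exists f : hom (x i.+1) (x i), f <> 0)].

Record kaut C := KAut {
  aut_fun :> kfunctor C C;
  aut_inv : kfunctor C C;
  aut_invK : kcomp aut_inv aut_fun = kid C;
  aut_funK : kcomp aut_fun aut_inv = kid C }.

Lemma kaut_eq C (H K : kaut C) : aut_fun H = aut_fun K -> H = K.
Proof.
case: H K => [H H' H1 H2] [K K' K1 K2] /= HK; case: K / HK K1 K2 => K1 K2.
have E : H' = K' by rewrite -[H']kcompf1 -K2 kcompA H1 kcomp1f.
by case: K' / E K1 K2 => K1 K2; congr KAut; apply: Prop_irrelevance.
Qed.

HB.instance Definition _ C := gen_eqMixin (kaut C).
HB.instance Definition _ C := gen_choiceMixin (kaut C).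

Section AutGroup.
Variable C : kcat k.
Implicit Types H K : kaut C.

Definition aut_one : kaut C := KAut (kcomp1f (kid C)) (kcomp1f (kid C)).

Definition aut_V H : kaut C := KAut (aut_funK H) (aut_invK H).

Definition aut_mul H K : kaut C.
Proof.
exists (kcomp H K) (kcomp (aut_inv K) (aut_inv H)).
- by rewrite kcompA -(kcompA (aut_inv K)) aut_invK kcompf1 aut_invK.
- by rewrite kcompA -(kcompA H) aut_funK kcompf1 aut_funK.
Defined.

Fact aut_mulA : associative aut_mul.
Proof. by move=> H K L; apply: kaut_eq; rewrite /= kcompA. Qed.
Fact aut_mul1 : left_id aut_one aut_mul.
Proof. by move=> H; apply: kaut_eq; rewrite /= kcomp1f. Qed.
Fact aut_mulr1 : right_id aut_one aut_mul.
Proof. by move=> H; apply: kaut_eq; rewrite /= kcompf1. Qed.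
Fact aut_mulV : left_inverse aut_one aut_V aut_mul.
Proof. by move=> H; apply: kaut_eq; rewrite /= aut_invK. Qed.
Fact aut_mulrV : right_inverse aut_one aut_V aut_mul.
Proof. by move=> H; apply: kaut_eq; rewrite /= aut_funK. Qed.

HB.instance Definition _ := isGroup.Build (kaut C)
  aut_mulA aut_mul1 aut_mulr1 aut_mulV aut_mulrV.

End AutGroup.

Section Aut1.
Variables (C B : kcat k) (F : kfunctor C B).

(* The pair (H, 1) is represented by its first component. *)
Definition aut1_pred : {pred kaut C} := fun H => `[< kcomp F H = F >].

Definition aut1 := {H : kaut C | H \in aut1_pred}.

Fact aut1_closed : group_closed aut1_pred.
Proof.
split=> [|H K /asboolP FH /asboolP FK]; apply/asboolP; first exact: kcompf1.
rewrite /= kcompA FH -{1}FK -kcompA.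
by rewrite (aut_funK K) kcompf1.
Qed.

HB.instance Definition _ := Choice.on aut1.
HB.instance Definition _ := [isSub of aut1 for @sval _ _].
HB.instance Definition _ :=
  SubChoice_isSubGroup.Build (kaut C) aut1_pred aut1 aut1_closed.

Definition aut1_action : UMagmaMorphism.type aut1 (kaut C) := (\val : aut1 -> kaut C).

Definition is_galois : Prop :=
  [/\ is_covering F, is_connected C &
    exists b : B, forall x y : C, F x = b -> F y = b ->
      exists H : aut1, aut1_action H x = y].

End Aut1.

End Categories.

Arguments hcast {k C x x' y y'} ex ey f : simpl never.

(* An action of G on C by k-linear automorphisms is a group morphism from G
   to [kaut C]. *)
Definition act_free (k : comPzRingType) (C : kcat k) (G : groupType)
    (a : UMagmaMorphism.type G (kaut C)) : Prop :=
  forall (g : G) (x : C), a g x = x -> g = 1%g.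

Section CategoricalQuotient.
Variables (k : comPzRingType) (C : kcat k) (G : groupType).
Variables (a : UMagmaMorphism.type G (kaut C)) (afree : act_free a).

Definition orbit_of (x : C) : set C := [set y | exists g : G, y = a g x].

(* Orbits, as subsets of the set of objects. *)
Definition qob := {alpha : set C | exists x, alpha = orbit_of x}.

Implicit Types alpha beta gamma : qob.

Definition elt alpha := {x : C | sval alpha x}.
Definition elt_val alpha (x : elt alpha) : C := sval x.
Local Coercion elt_val : elt >-> ob.

Lemma elt_eq alpha (x y : elt alpha) : x = y :> C -> x = y.
Proof.
by case: x y => x hx [y hy] /= xy; case: y / xy hy => hy; congr exist; apply: Prop_irrelevance.
Qed.

Lemma act1E (x : C) : a 1%g x = x.
Proof. by rewrite gmulf1. Qed.

Lemma actME (g h : G) (x : C) : a (g * h)%g x = a g (a h x).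
Proof. by rewrite gmulfM. Qed.

Fact orbit_act alpha (g : G) (x : C) : sval alpha x -> sval alpha (a g x).
Proof.
by case: alpha => al [x0 e] /=; rewrite e => -[h ->]; exists (g * h)%g; rewrite actME.
Qed.

Definition elt_act alpha (g : G) (x : elt alpha) : elt alpha :=
  exist _ (a g x) (orbit_act g (proj2_sig x)).

Fact orbit_trans alpha (x y : elt alpha) : exists g : G, a g x = y.
Proof.
case: alpha x y => al [x0 e] [x hx] [y hy]; rewrite /elt_val/=.
move: (hx) (hy); rewrite /= e => -[g ->] [h ->].
by exists (h * g^-1)%g; rewrite -actME divgK.
Qed.

Lemma act_uniq (g h : G) (x : C) : a g x = a h x -> g = h.
Proof.
move=> ghx; have /afree : a (h^-1 * g)%g x = x.
  by rewrite actME ghx -actME mulVg act1E.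
by move=> /(congr1 (fun s => h * s)%g); rewrite mulVKg mulg1.
Qed.

(* $\bigoplus_{x\in\alpha,y\in\beta}{}_y\mathcal{C}_x$ *)
Definition qsum alpha beta : lmodType k :=
  dsum (fun i : elt alpha * elt beta => hom (i.1 : C) (i.2 : C)).

Definition qsum_inj alpha beta (x : elt alpha) (y : elt beta) (f : hom x y) :
    qsum alpha beta :=
  dinj (M := fun i : elt alpha * elt beta => hom (i.1 : C) (i.2 : C)) (x, y) f.

Definition qsum_act alpha beta (g : G) : qsum alpha beta -> qsum alpha beta :=
  dlift (fun (i : elt alpha * elt beta) (f : hom (i.1 : C) (i.2 : C)) =>
    qsum_inj (x := elt_act g i.1) (y := elt_act g i.2) (fhom (a g) f)).

Definition qhom alpha beta : lmodType k := coinv (@qsum_act alpha beta).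

Definition qpr alpha beta : qsum alpha beta -> qhom alpha beta :=
  @coinv_pi k G (qsum alpha beta) (@qsum_act alpha beta).

Definition qcls alpha beta (x : elt alpha) (y : elt beta) (f : hom x y) :
  qhom alpha beta := qpr (qsum_inj f).

(* $[g][f]=[(sg)f]$ with $sy'=y$, for f from x to y and g from y' to z. *)
Definition qcomp_gen alpha beta gamma (x : elt alpha) (y y' : elt beta)
    (z : elt gamma) (g : hom y' z) (f : hom x y) : qhom alpha gamma :=
  let: exist s sy' := cid (orbit_trans y' y) in
  qcls (x := x) (y := elt_act s z)
    (comp (hcast sy' (erefl (a s z)) (fhom (a s) g)) f).

Definition qcomp_sum alpha beta gamma (u : qsum beta gamma) (v : qsum alpha beta) :
    qhom alpha gamma :=
  dlift (fun (j : elt beta * elt gamma) (g : hom (j.1 : C) (j.2 : C)) =>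
    dlift (fun (i : elt alpha * elt beta) (f : hom (i.1 : C) (i.2 : C)) =>
      qcomp_gen g f) v) u.

Definition qcomp alpha beta gamma (q : qhom beta gamma) (p : qhom alpha beta) :
    qhom alpha gamma :=
  qcomp_sum (repr q) (repr p).

Lemma qsum_inj_linear alpha beta (x : elt alpha) (y : elt beta) :
  linear (@qsum_inj _ _ x y).
Proof.
exact: (@dinj_linear _ _ (fun i : elt alpha * elt beta => hom (i.1 : C) (i.2 : C)) (x, y)).
Qed.

Lemma qpr_linear alpha beta : linear (@qpr alpha beta).
Proof. exact: coinv_pi_linear. Qed.

Lemma qcls_linear alpha beta (x : elt alpha) (y : elt beta) :
  linear (@qcls _ _ x y).
Proof. by move=> b f g; rewrite /qcls qsum_inj_linear qpr_linear. Qed.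

Lemma qsum_act_linear alpha beta g : linear (@qsum_act alpha beta g).
Proof.
by apply: dlift_linear => i b f h; rewrite fhom_lin qsum_inj_linear.
Qed.

Lemma qsum_act_inj alpha beta g (x : elt alpha) (y : elt beta) (f : hom x y) :
  qsum_act g (qsum_inj f) =
  qsum_inj (x := elt_act g x) (y := elt_act g y) (fhom (a g) f).
Proof.
rewrite /qsum_act {2}/qsum_inj dlift_inj //.
by move=> i b h h'; rewrite fhom_lin qsum_inj_linear.
Qed.

Lemma qsum_inj_cast alpha beta (x x' : elt alpha) (y y' : elt beta)
    (ex : x = x' :> C) (ey : y = y' :> C) (f : hom x y) :
  qsum_inj (x := x') (y := y') (hcast ex ey f) = qsum_inj f.
Proof.
have xx' := elt_eq ex; have yy' := elt_eq ey.
by case: x' / xx' ex; case: y' / yy' ey => ey ex; rewrite hcast_id.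
Qed.

Lemma qsum_act1 alpha beta (u : qsum alpha beta) : qsum_act 1%g u = u.
Proof.
apply: (@dlift_ext _ _ _ _ _ _ id) => [i b f h||i f] //.
  by rewrite fhom_lin qsum_inj_linear.
have /kfunctor_eqP[e He] : a 1%g = kid C :> kfunctor _ _ by rewrite gmulf1.
case: i f => x y f /=; rewrite -[f in LHS]/(fhom (kid C) f) -He.
exact: (qsum_inj_cast (x := elt_act 1%g x) (y := elt_act 1%g y)).
Qed.

Lemma qsum_actM alpha beta (g h : G) (u : qsum alpha beta) :
  qsum_act (g * h)%g u = qsum_act g (qsum_act h u).
Proof.
apply: (@dlift_ext _ _ _ _ _ _ (fun u => qsum_act g (qsum_act h u))) => [i b f f'||[x y] f].
- by rewrite fhom_lin qsum_inj_linear.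
- by move=> b v w; rewrite !qsum_act_linear.
have /kfunctor_eqP[e He] : a (g * h)%g = kcomp (a g) (a h) :> kfunctor _ _.
  by rewrite gmulfM.
rewrite -[dinj _ _]/(qsum_inj f) !qsum_act_inj.
have /= <- := He x y f.
exact (@qsum_inj_cast alpha beta
  (elt_act (g * h)%g x) (elt_act g (elt_act h x))
  (elt_act (g * h)%g y) (elt_act g (elt_act h y)) (e x) (e y)
  (fhom (a (g * h)%g) f)).
Qed.

Lemma qcls_act alpha beta g (x : elt alpha) (y : elt beta) (f : hom x y) :
  qcls (x := elt_act g x) (y := elt_act g y) (fhom (a g) f) = qcls f.
Proof.
rewrite /qcls -qsum_act_inj /qpr coinv_pi_act //.
exact: qsum_act1.
Qed.

Lemma qhom_ind alpha beta (P : qhom alpha beta -> Prop) :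
  P 0 ->
  (forall (x : elt alpha) (y : elt beta) (f : hom x y) q, P q -> P (qcls f + q)) ->
  forall q, P q.
Proof.
move=> P0 PD q; have [u <-] : exists u, qpr u = q := coinv_pi_surj q.
elim/dsum_ind: u => [|[x y] f u IHu].
  by rewrite (lin0 (@qpr_linear alpha beta)).
by rewrite (linD (@qpr_linear alpha beta)); apply: (PD x y f).
Qed.

Let ksrc alpha gamma (x : elt alpha) (y : C) (H : kfunctor C C) (y' z : C)
    (hz : sval gamma (H z)) (e : H y' = y) (g : hom y' z) (f : hom x y) :
    qhom alpha gamma :=
  qcls (x := x) (y := exist _ (H z) hz) (comp (hcast e (erefl (H z)) (fhom H g)) f).

Let ksrc_eq alpha gamma (x : elt alpha) (y : C) (H K : kfunctor C C) (y' z : C)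
    (hz : sval gamma (H z)) (hz' : sval gamma (K z)) (e : H y' = y) (e' : K y' = y)
    (g : hom y' z) (f : hom x y) :
  H = K -> ksrc hz e g f = ksrc hz' e' g f.
Proof.
move=> HK; case: K / HK hz' e' => hz' e'.
by rewrite (Prop_irrelevance hz hz') (Prop_irrelevance e e').
Qed.

Let hcast_fhom (D E : kcat k) (F : kfunctor D E) (x x' y y' : D) (ex : x = x')
    (ey : y = y') (f : hom x y) :
  fhom F (hcast ex ey f) = hcast (congr1 F ex) (congr1 F ey) (fhom F f).
Proof. by case: x' / ex; case: y' / ey. Qed.

Lemma qcomp_genE alpha beta gamma (x : elt alpha) (y y' : elt beta)
    (z : elt gamma) (g : hom y' z) (f : hom x y) (s : G) (e : a s y' = y) :
  qcomp_gen g f = qcls (x := x) (y := elt_act s z)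
    (comp (hcast e (erefl (a s z)) (fhom (a s) g)) f).
Proof.
rewrite /qcomp_gen; case: cid => t /= e'.
have ts : t = s by apply: (@act_uniq _ _ y'); rewrite e e'.
by case: s / ts e => e; rewrite (Prop_irrelevance e e').
Qed.

Lemma qcomp_gen_comp alpha beta gamma (x : elt alpha) (y : elt beta)
    (z : elt gamma) (g : hom y z) (f : hom x y) :
  qcomp_gen g f = qcls (comp g f).
Proof.
rewrite (qcomp_genE g f (act1E y)).
have /= := @ksrc_eq alpha gamma x y (a 1%g) (kid C) y z
  (orbit_act 1%g (proj2_sig z)) (proj2_sig z) (act1E y) erefl g f.
rewrite /ksrc /= => -> //; last by rewrite gmulf1.
by case: z g => z hz g.
Qed.

Lemma qcomp_gen_actl alpha beta gamma (t : G) (x : elt alpha) (y y' : elt beta)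
    (z : elt gamma) (g : hom y' z) (f : hom x y) :
  qcomp_gen (y' := elt_act t y') (z := elt_act t z) (fhom (a t) g) f = qcomp_gen g f.
Proof.
have [s e] := orbit_trans (elt_act t y') y.
rewrite (qcomp_genE (y' := elt_act t y') _ _ e).
have e' : a (s * t)%g y' = y by rewrite actME.
rewrite (qcomp_genE _ _ e').
apply: (@ksrc_eq alpha gamma x y (kcomp (a s) (a t)) (a (s * t)%g) y' z).
by rewrite gmulfM.
Qed.

Lemma qcomp_gen_actr alpha beta gamma (t : G) (x : elt alpha) (y y' : elt beta)
    (z : elt gamma) (g : hom y' z) (f : hom x y) :
  qcomp_gen (x := elt_act t x) (y := elt_act t y) g (fhom (a t) f) = qcomp_gen g f.
Proof.
have [s e] := orbit_trans y' y.
have e' : a (t * s)%g y' = elt_act t y by rewrite actME e.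
rewrite (qcomp_genE _ _ e) (qcomp_genE (x := elt_act t x) (y := elt_act t y) _ _ e').
rewrite -[RHS](qcls_act t) fhom_comp hcast_fhom.
apply: (@ksrc_eq alpha gamma (elt_act t x) (a t y) (a (t * s)%g) (kcomp (a t) (a s)) y' z).
by rewrite gmulfM.
Qed.

Lemma qcomp_gen_linl alpha beta gamma (x : elt alpha) (y y' : elt beta)
    (z : elt gamma) (f : hom x y) :
  linear (fun g : hom y' z => qcomp_gen g f).
Proof.
have [s e] := orbit_trans y' y.
move=> b g h; rewrite !(qcomp_genE _ _ e) fhom_lin -qcls_linear -comp_linl.
by congr (qcls (comp _ _)); case: (y : C) / e.
Qed.

Lemma qcomp_gen_linr alpha beta gamma (x : elt alpha) (y y' : elt beta)
    (z : elt gamma) (g : hom y' z) :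
  linear (fun f : hom x y => qcomp_gen g f).
Proof.
have [s e] := orbit_trans y' y.
by move=> b f h; rewrite !(qcomp_genE _ _ e) comp_linr qcls_linear.
Qed.

Let liftr_lin alpha beta gamma (y' : elt beta) (z : elt gamma) (g : hom y' z) :
  linear (dlift (fun (i : elt alpha * elt beta) (f : hom (i.1 : C) (i.2 : C)) =>
    qcomp_gen g f)).
Proof. by apply: dlift_linear => i; apply: qcomp_gen_linr. Qed.

Let liftl_lin alpha beta gamma (v : qsum alpha beta) (j : elt beta * elt gamma) :
  linear (fun g : hom (j.1 : C) (j.2 : C) =>
    dlift (fun (i : elt alpha * elt beta) (f : hom (i.1 : C) (i.2 : C)) =>
      qcomp_gen g f) v).
Proof.
case: j => [y' z] b g h /=.
elim/dsum_ind: v => [|[x y] f v IHv].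
  by rewrite !(fun l => lin0 (@liftr_lin alpha beta gamma y' z l)) scaler0 addr0.
rewrite !(fun l => linD (@liftr_lin alpha beta gamma y' z l)) IHv !dlift_inj;
  try by move=> i; apply: qcomp_gen_linr.
by rewrite qcomp_gen_linl scalerDr addrACA.
Qed.

Lemma qcomp_sum_linl alpha beta gamma (v : qsum alpha beta) :
  linear (fun u : qsum beta gamma => qcomp_sum u v).
Proof. by apply: dlift_linear => j; apply: liftl_lin. Qed.

Let qcomp_sum_injl alpha beta gamma (y' : elt beta) (z : elt gamma)
    (g : hom y' z) (v : qsum alpha beta) :
  qcomp_sum (qsum_inj g) v =
  dlift (fun (i : elt alpha * elt beta) (f : hom (i.1 : C) (i.2 : C)) =>
    qcomp_gen g f) v.
Proof.
by rewrite /qcomp_sum /qsum_inj dlift_inj // => j; apply: liftl_lin.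
Qed.

Lemma qcomp_sum_inj alpha beta gamma (x : elt alpha) (y y' : elt beta)
    (z : elt gamma) (g : hom y' z) (f : hom x y) :
  qcomp_sum (qsum_inj g) (qsum_inj f) = qcomp_gen g f.
Proof.
by rewrite qcomp_sum_injl /qsum_inj dlift_inj // => j; apply: qcomp_gen_linr.
Qed.

Lemma qcomp_sum_linr alpha beta gamma (u : qsum beta gamma) :
  linear (fun v : qsum alpha beta => qcomp_sum u v).
Proof.
move=> b v w; elim/dsum_ind: u => [|[y z] g u IHu].
  by rewrite !(fun v => lin0 (@qcomp_sum_linl alpha beta gamma v)) scaler0 addr0.
rewrite !(fun v => linD (@qcomp_sum_linl alpha beta gamma v)) IHu.
rewrite -[dinj _ _]/(qsum_inj g) !qcomp_sum_injl liftr_lin.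
by rewrite scalerDr addrACA.
Qed.

Let qcomp_sum_eq alpha beta gamma (N : lmodType k)
    (T T' : qsum beta gamma -> qsum alpha beta -> N) :
  (forall v, linear (T^~ v)) -> (forall u, linear (T u)) ->
  (forall v, linear (T'^~ v)) -> (forall u, linear (T' u)) ->
  (forall (x : elt alpha) (y y' : elt beta) (z : elt gamma)
     (g : hom y' z) (f : hom x y),
     T (qsum_inj g) (qsum_inj f) = T' (qsum_inj g) (qsum_inj f)) ->
  forall u v, T u v = T' u v.
Proof.
move=> Tl Tr Tl' Tr' TT' u v; elim/dsum_ind: u => [|[y' z] g u IHu].
  by rewrite (lin0 (Tl v)) (lin0 (Tl' v)).
rewrite (linD (Tl v)) (linD (Tl' v)) IHu; congr (_ + _).
elim/dsum_ind: v {IHu} => [|[x y] f v IHv].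
  by rewrite (lin0 (Tr _)) (lin0 (Tr' _)).
by rewrite (linD (Tr _)) (linD (Tr' _)) IHv; congr (_ + _); apply: TT'.
Qed.

Lemma qcomp_sum_actl alpha beta gamma (t : G) (u : qsum beta gamma)
    (v : qsum alpha beta) :
  qcomp_sum (qsum_act t u) v = qcomp_sum u v.
Proof.
apply: (@qcomp_sum_eq alpha beta gamma _
  (fun u v => qcomp_sum (qsum_act t u) v) (fun u v => qcomp_sum u v)) => [w|w|w|w|].
- by move=> b p q; rewrite qsum_act_linear; apply: qcomp_sum_linl.
- exact: qcomp_sum_linr.
- exact: qcomp_sum_linl.
- exact: qcomp_sum_linr.
move=> x y y' z g f; rewrite qsum_act_inj !qcomp_sum_inj.
exact: qcomp_gen_actl.
Qed.

Lemma qcomp_sum_actr alpha beta gamma (t : G) (u : qsum beta gamma)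
    (v : qsum alpha beta) :
  qcomp_sum u (qsum_act t v) = qcomp_sum u v.
Proof.
apply: (@qcomp_sum_eq alpha beta gamma _
  (fun u v => qcomp_sum u (qsum_act t v)) (fun u v => qcomp_sum u v)) => [w|w|w|w|].
- exact: qcomp_sum_linl.
- by move=> b p q; rewrite qsum_act_linear; apply: qcomp_sum_linr.
- exact: qcomp_sum_linl.
- exact: qcomp_sum_linr.
move=> x y y' z g f; rewrite qsum_act_inj !qcomp_sum_inj.
exact: qcomp_gen_actr.
Qed.

Lemma qcompE alpha beta gamma (u : qsum beta gamma) (v : qsum alpha beta) :
  qcomp (qpr u) (qpr v) = qcomp_sum u v.
Proof.
rewrite /qcomp; set u' := repr _; set v' := repr _.
have uu' : u' - u \in aug_sub (@qsum_act beta gamma).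
  by apply/coinv_piP; apply: qpi_surj.
have vv' : v' - v \in aug_sub (@qsum_act alpha beta).
  by apply/coinv_piP; apply: qpi_surj.
have := aug_sub_kill (@qcomp_sum_linl alpha beta gamma v')
  (fun t w => qcomp_sum_actl t w v') uu'.
have := aug_sub_kill (@qcomp_sum_linr alpha beta gamma u)
  (fun t w => qcomp_sum_actr t u w) vv'.
rewrite addrC -scaleN1r qcomp_sum_linr scaleN1r addrC => /subr0_eq Ev.
rewrite addrC -scaleN1r qcomp_sum_linl scaleN1r addrC => /subr0_eq Eu.
by rewrite Eu Ev.
Qed.

Let qpr_surj alpha beta (q : qhom alpha beta) : exists u, qpr u = q.
Proof. exact: coinv_pi_surj. Qed.

Lemma qcomp_linl alpha beta gamma (p : qhom alpha beta) :
  linear (fun q : qhom beta gamma => qcomp q p).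
Proof.
move=> b q r; have [u <-] := qpr_surj q; have [w <-] := qpr_surj r.
have [v <-] := qpr_surj p.
by rewrite -qpr_linear !qcompE qcomp_sum_linl.
Qed.

Lemma qcomp_linr alpha beta gamma (q : qhom beta gamma) :
  linear (fun p : qhom alpha beta => qcomp q p).
Proof.
move=> b p r; have [u <-] := qpr_surj q; have [v <-] := qpr_surj p.
have [w <-] := qpr_surj r.
by rewrite -qpr_linear !qcompE qcomp_sum_linr.
Qed.

Lemma qcomp_cls_gen alpha beta gamma (x : elt alpha) (y y' : elt beta)
    (z : elt gamma) (g : hom y' z) (f : hom x y) :
  qcomp (qcls g) (qcls f) = qcomp_gen g f.
Proof. by rewrite /qcls qcompE qcomp_sum_inj. Qed.

Lemma qcomp_cls alpha beta gamma (x : elt alpha) (y : elt beta)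
    (z : elt gamma) (g : hom y z) (f : hom x y) :
  qcomp (qcls g) (qcls f) = qcls (comp g f).
Proof. by rewrite qcomp_cls_gen qcomp_gen_comp. Qed.

Lemma qcls_align alpha beta (x y : elt alpha) (z : elt beta) (f : hom x z) :
  exists (z' : elt beta) (f' : hom y z'), qcls f' = qcls f.
Proof.
have [s e] := orbit_trans x y; have {e} <- : elt_act s x = y by apply: elt_eq.
by exists (elt_act s z), (fhom (a s) f); apply: qcls_act.
Qed.

Definition qelt alpha : elt alpha.
Proof.
exists (sval (cid (proj2_sig alpha))).
case: cid => x /= e; have -> : sval alpha = orbit_of x := e.
by exists 1%g; rewrite act1E.
Defined.

Definition qid alpha : qhom alpha alpha := qcls (idm (qelt alpha : C)).

Lemma qid_cls alpha (x : elt alpha) : qid alpha = qcls (idm (x : C)).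
Proof.
have [s e] := orbit_trans (qelt alpha) x.
have {e} <- : elt_act s (qelt alpha) = x by apply: elt_eq.
by rewrite /qid -(qcls_act s) fhom_id.
Qed.

Fact qcomp_idl alpha beta (p : qhom alpha beta) : qcomp (qid beta) p = p.
Proof.
elim/qhom_ind: p => [|x y f p IHp]; first exact: (lin0 (qcomp_linr _)).
by rewrite (linD (qcomp_linr _)) IHp (qid_cls y) qcomp_cls comp_idl.
Qed.

Fact qcomp_idr alpha beta (p : qhom alpha beta) : qcomp p (qid alpha) = p.
Proof.
elim/qhom_ind: p => [|x y f p IHp]; first exact: (lin0 (qcomp_linl _)).
by rewrite (linD (qcomp_linl _)) IHp (qid_cls x) qcomp_cls comp_idr.
Qed.

Fact qcompA alpha beta gamma delta (r : qhom gamma delta) (q : qhom beta gamma)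
    (p : qhom alpha beta) :
  qcomp r (qcomp q p) = qcomp (qcomp r q) p.
Proof.
elim/qhom_ind: p => [|x y f p IHp].
  by rewrite !(lin0 (qcomp_linr _)).
rewrite !(linD (qcomp_linr _)) IHp; congr (_ + _).
elim/qhom_ind: q {p IHp} => [|y' z g q IHq].
  by rewrite (lin0 (qcomp_linl _)) !(lin0 (qcomp_linr _)) (lin0 (qcomp_linl _)).
rewrite (linD (qcomp_linl _)) !(linD (qcomp_linr _)) (linD (qcomp_linl _)) IHq.
congr (_ + _); have [z1 [g1 <-]] := qcls_align y g.
elim/qhom_ind: r {q IHq} => [|z' w h r IHr].
  by rewrite !(lin0 (qcomp_linl _)).
rewrite !(linD (qcomp_linl _)) IHr; congr (_ + _).
have [w1 [h1 <-]] := qcls_align z1 h.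
by rewrite !qcomp_cls compA.
Qed.

Definition quotient_cat : kcat k :=
  @KCat k qob qhom qid qcomp qcomp_linl qcomp_linr qcomp_idl qcomp_idr qcompA.

Definition orbit (x : C) : quotient_cat :=
  exist _ (orbit_of x) (ex_intro _ x erefl).

Definition orbit_elt (x : C) : elt (orbit x) :=
  exist _ x (ex_intro _ 1%g (esym (act1E x))).

Definition quotient_proj : kfunctor C quotient_cat.
Proof.
exists orbit (fun (x y : C) (f : hom x y) =>
  qcls (x := orbit_elt x) (y := orbit_elt y) f).
- by move=> x y; apply: (@qcls_linear _ _ (orbit_elt x) (orbit_elt y)).
- by move=> x; rewrite [RHS](qid_cls (orbit_elt x)).
- by move=> x y z g f; rewrite [RHS](@qcomp_cls _ _ _ (orbit_elt x) (orbit_elt y) (orbit_elt z)).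
Defined.

End CategoricalQuotient.

Section Aut1Free.
Variables (k : comPzRingType) (C B : kcat k) (F : kfunctor C B).
Hypothesis Fcov : is_covering F.
Variable H : aut1 F.
Let h : kfunctor C C := aut1_action F H.

Let Fh : kcomp F h = F.
Proof. exact/asboolP/(valP H). Qed.

Let dinjr_cast (D : kcat k) (x x' y y' : D) (e e' : x = x') (ey : y = y')
    (f : hom x y) :
  dinj (M := fun v : D => hom x' v) y' (hcast e ey f) =
  dinj (M := fun v : D => hom x' v) y (hcast e' erefl f).
Proof.
by case: y' / ey; rewrite (Prop_irrelevance e e').
Qed.

Let dinjl_cast (D : kcat k) (x x' y y' : D) (e e' : x = x') (ey : y = y')
    (f : hom y x) :
  dinj (M := fun v : D => hom v x') y' (hcast ey e f) =
  dinj (M := fun v : D => hom v x') y (hcast erefl e' f).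
Proof.
by case: y' / ey; rewrite (Prop_irrelevance e e').
Qed.

Let fhom_hcast (D E : kcat k) (K : kfunctor D E) (x x' y y' : D) (ex : x = x')
    (ey : y = y') (f : hom x y) :
  fhom K (hcast ex ey f) = hcast (congr1 K ex) (congr1 K ey) (fhom K f).
Proof. by case: x' / ex; case: y' / ey. Qed.

Let star_r (y z : C) (ey : h y = y) (f : hom y z) :
  dinj (M := fun v : C => hom y v) z f =
  dinj (M := fun v : C => hom y v) (h z) (hcast ey erefl (fhom h f)).
Proof.
have [e He] := (kfunctor_eqP _ _).1 Fh.
have /bij_inj inj := Fcov.2 y.
have /(congr1 fst) // : (dinj (M := fun v : C => hom y v) z f, 0) =
  (dinj (M := fun v : C => hom y v) (h z) (hcast ey erefl (fhom h f)), 0) :> star y.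
apply: inj; congr pair; rewrite /= !dlift_inj;
  try by move=> v a g g'; rewrite fhom_lin dinj_linear.
by rewrite fhom_hcast -He; apply: dinjr_cast.
Qed.

Let star_l (y z : C) (ey : h y = y) (f : hom z y) :
  dinj (M := fun v : C => hom v y) z f =
  dinj (M := fun v : C => hom v y) (h z) (hcast erefl ey (fhom h f)).
Proof.
have [e He] := (kfunctor_eqP _ _).1 Fh.
have /bij_inj inj := Fcov.2 y.
have /(congr1 snd) // : (0, dinj (M := fun v : C => hom v y) z f) =
  (0, dinj (M := fun v : C => hom v y) (h z) (hcast erefl ey (fhom h f))) :> star y.
apply: inj; congr pair; rewrite /= !dlift_inj;
  try by move=> v a g g'; rewrite fhom_lin dinj_linear.
by rewrite fhom_hcast -He; apply: dinjl_cast.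
Qed.

Let fix_r (y z : C) (f : hom y z) : f <> 0 -> h y = y -> h z = z.
Proof.
move=> f0 ey; apply: contrapT => hz; apply: f0.
have /(congr1 (fun u : dsum _ => u z)) := star_r ey f.
by rewrite dinjE dinj_neq.
Qed.

Let fix_l (y z : C) (f : hom z y) : f <> 0 -> h y = y -> h z = z.
Proof.
move=> f0 ey; apply: contrapT => hz; apply: f0.
have /(congr1 (fun u : dsum _ => u z)) := star_l ey f.
by rewrite dinjE dinj_neq.
Qed.

Lemma aut1_fix (x : C) : is_connected C -> h x = x -> H = 1%g.
Proof.
move=> Cconn hx.
have hfix y : h y = y.
  have [n [p [p0 pn pE]]] := Cconn x y; rewrite -pn.
  elim: n {pn} pE => [|n IHn] pE; first by rewrite p0.
  have hn : h (p n) = p n by apply: IHn => i ilt; apply: pE; apply: ltnW.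
  have [[f f0]|[f f0]] := pE n (ltnSn n); first exact: (fix_r f0).
  exact: (fix_l f0).
apply/val_inj/kaut_eq/kfunctor_eqP; exists hfix => y z f /=.
have := star_r (hfix y) f.
rewrite -(@dinjr_cast _ _ _ _ _ (hfix y) (hfix y) (hfix z)).
by move=> /(congr1 (fun u : dsum _ => u z)); rewrite !dinjE.
Qed.

End Aut1Free.

Lemma galois_free (k : comPzRingType) (C B : kcat k) (F : kfunctor C B) :
  is_galois F -> act_free (aut1_action F).
Proof. by move=> [Fcov Cconn _] H x; apply: aut1_fix. Qed.

(* Main.v *)
Require Import Defs.
From mathcomp Require Import all_boot all_order ssralg.
From mathcomp Require Import boolp classical_sets.

Set Implicit Arguments.
Unset Strict Implicit.
Unset Printing Implicit Defensive.

Import GRing.Theory.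
Local Open Scope ring_scope.

(** Write G for Aut_1(F).  The functor F is constant on G-orbits and on
coinvariant classes, so it factors as F = F'P through the categorical quotient,
and the factorization is unique because every object of C/G is some P x and
every morphism of C/G is a sum of classes of morphisms of C
([quotient_lift_proj], [quotient_proj_epi]).

What has to be shown is that F' is an isomorphism.  A covering decomposes the
morphisms of B: for a fixed lift x of b, the module of morphisms from b to c is
the direct sum, over all y above c, of the modules of morphisms from x to y in
C; symmetrically when the target is lifted.  This is used in the form of a
generation principle ([covering_out_ind], [covering_in_ind]) and of an extension
principle for linear maps ([covering_out_lift], [covering_in_lift]).  The
morphisms of C/G from an orbit alpha to an orbit beta can all be represented
with source a chosen x in alpha, so they also are the direct sum of the
morphisms x -> y with y in beta.  Hence F' is bijective on morphisms as soon as
beta is the whole fibre, that is, as soon as G is transitive on every fibre;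
the same property makes F' injective on objects.

Transitivity is assumed on one fibre only, and it propagates along nonzero
morphisms ([fibre_transitive_out], [fibre_transitive_in]), hence everywhere
since C is connected.  Suppose that f : x -> y is nonzero, that G is transitive
above F x, and let y' be another object above F y.  Lifting the target at y',
F f is a sum of morphisms F h with h : s x -> y' and s in G; applying the
inverse of s, it is a sum of images of morphisms from x to various s^-1 y'.
Lifting the source at x instead, F f has the single component f, at y.  As f is
not zero, y is one of the objects s^-1 y'.

Finally P is the composite of F with the inverse of F', and composing a Galois
covering with an isomorphism gives a Galois covering ([galois_kiso_comp]). *)

(** * Transport of morphisms along equalities of objects *)

Section Transport.
Variables (k : comPzRingType) (C D : kcat k).

Lemma hcast_linear (x x' y y' : C) (ex : x = x') (ey : y = y') :
  linear (hcast ex ey).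
Proof. by case: x' / ex; case: y' / ey => a f g; rewrite !hcast_id. Qed.

Lemma hcast_trans (x x' x'' y y' y'' : C) (ex : x = x') (ey : y = y')
    (ex' : x' = x'') (ey' : y' = y'') (f : hom x y) :
  hcast ex' ey' (hcast ex ey f) = hcast (etrans ex ex') (etrans ey ey') f.
Proof. by case: x'' / ex'; case: y'' / ey'; rewrite hcast_id. Qed.

Lemma hcast_idm (x x' : C) (e e' : x = x') : hcast e e' (idm x) = idm x'.
Proof. by case: x' / e e' => e'; rewrite hcast_id. Qed.

Lemma hcast_comp (x x' y y' z z' : C) (ex : x = x') (ey : y = y') (ez : z = z')
    (g : hom y z) (f : hom x y) :
  hcast ex ez (Defs.comp g f) = Defs.comp (hcast ey ez g) (hcast ex ey f).
Proof. by case: x' / ex; case: y' / ey; case: z' / ez; rewrite !hcast_id. Qed.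

Lemma fhom_hcast (F : kfunctor C D) (x x' y y' : C) (ex : x = x')
    (ey : y = y') (f : hom x y) :
  fhom F (hcast ex ey f) = hcast (congr1 F ex) (congr1 F ey) (fhom F f).
Proof. by case: x' / ex; case: y' / ey. Qed.

Lemma kfunctor_eq_fhom (F F' : kfunctor C D) (x y : C) (f : hom x y)
    (ex : F x = F' x) (ey : F y = F' y) :
  F = F' -> hcast ex ey (fhom F f) = fhom F' f.
Proof. by move=> FF'; case: F' / FF' ex ey => ex ey; rewrite hcast_id. Qed.

End Transport.

Lemma can_linear (k : comPzRingType) (U V : lmodType k)
    (f : U -> V) (g : V -> U) :
  linear f -> cancel f g -> cancel g f -> linear g.
Proof. by move=> flin fK gK a u v; apply: (can_inj fK); rewrite flin !gK. Qed.

(** * Morphisms of the base of a covering *)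

Section CoveringHom.
Variables (k : comPzRingType) (C B : kcat k) (F : kfunctor C B).

Lemma fhom_out_linear (x y : C) : linear (fun f : hom x y =>
  dinj (M := fun b : B => hom (F x) b) (F y) (fhom F f)).
Proof. by move=> a f g; rewrite fhom_lin dinj_linear. Qed.

Lemma fhom_in_linear (y x : C) : linear (fun f : hom x y =>
  dinj (M := fun b : B => hom b (F y)) (F x) (fhom F f)).
Proof. by move=> a f g; rewrite fhom_lin dinj_linear. Qed.

Hypothesis Fcov : is_covering F.

(** Surjectivity of the star maps, read one pair of objects at a time: the
component at c of an element of the star at x is a sum of images of morphisms
ending above c. *)
Lemma covering_out_ind (x : C) (b c : B) (eb : F x = b) (P : hom b c -> Prop) :
  P 0 -> (forall u v, P u -> P v -> P (u + v)) ->
  (forall y (ec : F y = c) (f : hom x y), P (hcast eb ec (fhom F f))) ->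
  forall g, P g.
Proof.
case: b / eb P => P P0 PD PF g; have [S' _ SK] := Fcov.2 x.
have /(congr1 (fun w : star (F x) => w.1 c)) := SK (dinj c g, 0).
rewrite [RHS]dinjE => <-; move: (S' _) => [u v] /=; move: u {v} => u.
have Slin := @fhom_out_linear x.
elim/dsum_ind: u => [|y f u IHu]; first by rewrite (lin0 (dlift_linear Slin)).
rewrite (linD (dlift_linear Slin)) dsumDE; apply: PD IHu.
rewrite (dlift_inj Slin); have [e|ne] := pselect (F y = c).
  move: (PF y e f) => {P0 PF g}; case: c / e P => P.
  by rewrite dinjE hcast_id.
by rewrite (dinj_neq _ ne).
Qed.

Lemma covering_in_ind (y : C) (b c : B) (ec : F y = c) (P : hom b c -> Prop) :
  P 0 -> (forall u v, P u -> P v -> P (u + v)) ->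
  (forall x (eb : F x = b) (f : hom x y), P (hcast eb ec (fhom F f))) ->
  forall g, P g.
Proof.
case: c / ec P => P P0 PD PF g; have [S' _ SK] := Fcov.2 y.
have /(congr1 (fun w : star (F y) => w.2 b)) := SK (0, dinj b g).
rewrite [RHS]dinjE => <-; move: (S' _) => [v u] /=; move: u {v} => u.
have Slin := @fhom_in_linear y.
elim/dsum_ind: u => [|x f u IHu]; first by rewrite (lin0 (dlift_linear Slin)).
rewrite (linD (dlift_linear Slin)) dsumDE; apply: PD IHu.
rewrite (dlift_inj Slin); have [e|ne] := pselect (F x = b).
  move: (PF x e f) => {P0 PF g}; case: b / e P => P.
  by rewrite dinjE hcast_id.
by rewrite (dinj_neq _ ne).
Qed.

(** Injectivity of the star maps in the form of a universal property: inverting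
the star map at x splits a morphism F x -> c into its components x -> y, and
phi can then be applied to each of them.  It provides the projection onto one
summand as well as the inverse of a functor with source C/G. *)
Lemma covering_out_lift (x : C) (c : B) (N : lmodType k)
    (phi : forall y, F y = c -> hom x y -> N) :
  (forall y e, linear (@phi y e)) ->
  exists2 L : hom (F x) c -> N, linear L &
    forall y e (f : hom x y), L (hcast erefl e (fhom F f)) = phi y e f.
Proof.
move=> phi_lin; have [S' KS SK] := Fcov.2 x.
have S'lin := can_linear (@star_map_linear _ _ _ F x) KS SK.
(* Summands that do not lie above c are killed. *)
pose psi y (f : hom x y) : N :=
  if pselect (F y = c) is left e then phi y e f else 0.
have psi_lin y : linear (@psi y).
  by rewrite /psi; case: pselect => e a f g; rewrite ?phi_lin ?scaler0 ?addr0.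
exists (fun g => dlift psi (S' (dinj c g, 0)).1) => [a g h|y e f].
  rewrite -(dlift_linear psi_lin); congr (dlift psi _).
  rewrite -[RHS]/((a *: S' (dinj c g, 0) + S' (dinj c h, 0)).1) -S'lin.
  by congr (S' _).1; congr pair; rewrite ?dinj_linear //= scaler0 addr0.
have -> : (dinj c (hcast erefl e (fhom F f)), 0) =
    star_map F (x := x) (dinj y f, 0) :> star (F x).
  congr pair.
    rewrite (dlift_inj (@fhom_out_linear x)).
    by case: c / e {phi phi_lin psi psi_lin}; rewrite hcast_id.
  by rewrite (lin0 (dlift_linear (@fhom_in_linear x))).
rewrite KS (dlift_inj psi_lin) /psi; case: pselect => // e'.
by rewrite (Prop_irrelevance e' e).
Qed.

Lemma covering_in_lift (y : C) (b : B) (N : lmodType k)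
    (phi : forall x, F x = b -> hom x y -> N) :
  (forall x e, linear (@phi x e)) ->
  exists2 L : hom b (F y) -> N, linear L &
    forall x e (f : hom x y), L (hcast e erefl (fhom F f)) = phi x e f.
Proof.
move=> phi_lin; have [S' KS SK] := Fcov.2 y.
have S'lin := can_linear (@star_map_linear _ _ _ F y) KS SK.
pose psi x (f : hom x y) : N :=
  if pselect (F x = b) is left e then phi x e f else 0.
have psi_lin x : linear (@psi x).
  by rewrite /psi; case: pselect => e a f g; rewrite ?phi_lin ?scaler0 ?addr0.
exists (fun g => dlift psi (S' (0, dinj b g)).2) => [a g h|x e f].
  rewrite -(dlift_linear psi_lin); congr (dlift psi _).
  rewrite -[RHS]/((a *: S' (0, dinj b g) + S' (0, dinj b h)).2) -S'lin.
  by congr (S' _).2; congr pair; rewrite ?dinj_linear //= scaler0 addr0.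
have -> : (0, dinj b (hcast e erefl (fhom F f))) =
    star_map F (x := y) (0, dinj x f) :> star (F y).
  congr pair; last first.
    rewrite (dlift_inj (@fhom_in_linear y)).
    by case: b / e {phi phi_lin psi psi_lin}; rewrite hcast_id.
  by rewrite (lin0 (dlift_linear (@fhom_out_linear y))).
rewrite KS (dlift_inj psi_lin) /psi; case: pselect => // e'.
by rewrite (Prop_irrelevance e' e).
Qed.

End CoveringHom.

(** * Transitivity on all fibres *)

Section Transitivity.
Variables (k : comPzRingType) (C B : kcat k) (F : kfunctor C B).

Lemma aut1_comp (H : aut1 F) : kcomp F (aut1_action F H) = F.
Proof. exact/asboolP/(valP H). Qed.

Lemma fob_aut1 (H : aut1 F) (x : C) : F (aut1_action F H x) = F x.
Proof. by rewrite -[in RHS](aut1_comp H). Qed.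

(** The identity FH = F on morphisms.  Objects are kept up to equality so that
H f can be viewed as a morphism between prescribed objects, whatever the
equality proofs used to place F f in a given module of B. *)
Lemma fhom_aut1 (H : aut1 F) (x y x' y' : C) (b c : B)
    (ex : aut1_action F H x = x') (ey : aut1_action F H y = y')
    (eb : F x = b) (ec : F y = c) (eb' : F x' = b) (ec' : F y' = c)
    (f : hom x y) :
  hcast eb' ec' (fhom F (hcast ex ey (fhom (aut1_action F H) f))) =
  hcast eb ec (fhom F f).
Proof.
case: x' / ex eb'; case: y' / ey ec' => ec' eb'; rewrite hcast_id.
rewrite -(@kfunctor_eq_fhom _ _ _ (kcomp F _) F x y f
  (fob_aut1 H x) (fob_aut1 H y) (aut1_comp H)) hcast_trans.
by congr (hcast _ _ _); apply: Prop_irrelevance.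
Qed.

Definition fibre_transitive (b : B) : Prop :=
  forall x y : C, F x = b -> F y = b -> exists H : aut1 F, aut1_action F H x = y.

Lemma fibre_transitive_from (x : C) :
  (forall y, F y = F x -> exists H : aut1 F, aut1_action F H y = x) ->
  fibre_transitive (F x).
Proof.
move=> reach y z yx zx; have [H Hy] := reach y yx; have [K Kz] := reach z zx.
exists (K^-1 * H)%g; rewrite (actME) Hy -Kz -actME mulVg.
exact: act1E.
Qed.

Hypothesis Fcov : is_covering F.

(** L is the projection of the morphisms F x -> F y onto the component at y.  If
y' is not in the orbit of y, every generator F h with h : z -> y' is moved by
some H with H z = x to a morphism from x to H y' <> y, so L vanishes on all
generators, although L (F f) = f. *)
Lemma fibre_transitive_out (x y : C) (f : hom x y) : f <> 0 ->
  fibre_transitive (F x) -> fibre_transitive (F y).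
Proof.
move=> f0 Tx; apply: fibre_transitive_from => y' ey'; apply: contrapT => noH.
pose phi z (e : F z = F y) (h : hom x z) : hom x y :=
  if pselect (z = y) is left e' then hcast erefl e' h else 0.
have phi_lin z e : linear (@phi z e).
  rewrite /phi; case: pselect => e' a g h; first exact: hcast_linear.
  by rewrite scaler0 addr0.
have [L Llin LF] := covering_out_lift Fcov phi_lin.
apply: f0; transitivity (L (fhom F f)).
  have := LF y erefl f; rewrite hcast_id => ->; rewrite /phi.
  by case: pselect => // e; rewrite hcast_id.
move: (fhom F f).
apply: (covering_in_ind Fcov (ec := ey')
  (P := fun g => L g = 0)) => [|u v Lu Lv|z ez h].
- exact: (lin0 Llin).
- by rewrite (linD Llin) Lu Lv addr0.
have [H Hz] := Tx z x ez erefl.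
have eH : F (aut1_action F H y') = F y by rewrite fob_aut1.
rewrite -(fhom_aut1 Hz erefl ez ey' erefl eH) LF /phi.
by case: pselect => // e; case: noH; exists H.
Qed.

Lemma fibre_transitive_in (x y : C) (f : hom x y) : f <> 0 ->
  fibre_transitive (F y) -> fibre_transitive (F x).
Proof.
move=> f0 Ty; apply: fibre_transitive_from => x' ex'; apply: contrapT => noH.
pose phi z (e : F z = F x) (h : hom z y) : hom x y :=
  if pselect (z = x) is left e' then hcast e' erefl h else 0.
have phi_lin z e : linear (@phi z e).
  rewrite /phi; case: pselect => e' a g h; first exact: hcast_linear.
  by rewrite scaler0 addr0.
have [L Llin LF] := covering_in_lift Fcov phi_lin.
apply: f0; transitivity (L (fhom F f)).
  have := LF x erefl f; rewrite hcast_id => ->; rewrite /phi.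
  by case: pselect => // e; rewrite hcast_id.
move: (fhom F f).
apply: (covering_out_ind Fcov (eb := ex')
  (P := fun g => L g = 0)) => [|u v Lu Lv|z ez h].
- exact: (lin0 Llin).
- by rewrite (linD Llin) Lu Lv addr0.
have [H Hz] := Ty z y ez erefl.
have eH : F (aut1_action F H x') = F x by rewrite fob_aut1.
rewrite -(fhom_aut1 erefl Hz ex' ez eH erefl) LF /phi.
by case: pselect => // e; case: noH; exists H.
Qed.

End Transitivity.

Lemma galois_fibre_transitive (k : comPzRingType) (C B : kcat k)
    (F : kfunctor C B) (b : B) : is_galois F -> fibre_transitive F b.
Proof.
move=> [Fcov Cconn [b0 Tb0]].
have [x0 ex0] := Fcov.1 b0; have [x <-] := Fcov.1 b.
have [n [p [p0 <- pE]]] := Cconn x0 x.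
elim: n pE => [_|n IHn pE]; first by rewrite p0 ex0.
have {IHn} Tn : fibre_transitive F (F (p n)).
  by apply: IHn => i ilt; apply: pE; apply: ltnW.
have [[f f0]|[f f0]] := pE n (ltnSn n).
  exact: (fibre_transitive_out Fcov f0).
exact: (fibre_transitive_in Fcov f0).
Qed.

(** * Universal property of the categorical quotient *)

Section QuotientUniversal.
Variables (k : comPzRingType) (C B : kcat k) (G : groupType).
Variables (a : UMagmaMorphism.type G (kaut C)) (afree : act_free a).
Local Coercion elt_val : elt >-> ob.
Implicit Types alpha beta gamma : qob a.
Notation P := (quotient_proj afree).

Lemma quotient_ob_proj alpha (x : elt alpha) : P x = alpha.
Proof.
case: alpha x => al [x0 e0] [x hx]; apply: eq_exist; rewrite /elt_val /=.
move: (hx); rewrite /= e0 => -[g ->]; apply/seteqP; split => _ [h ->].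
  by exists (h * g)%g; rewrite actME.
by exists (h * g^-1)%g; rewrite -actME divgK.
Qed.

Lemma quotient_proj_act g (x : C) : P (a g x) = P x.
Proof.
apply: (@quotient_ob_proj (P x) (exist _ (a g x) _)).
by exists g.
Qed.

(** A class [qcls f] is built from elements x and y of given orbits, while P f
has source P x and target P y, which are only provably equal to these orbits. *)
Lemma qcls_proj alpha beta (x : elt alpha) (y : elt beta) (f : hom x y)
    (ex : P x = alpha) (ey : P y = beta) :
  qcls f = hcast ex ey (fhom P f) :> @hom _ (quotient_cat afree) alpha beta.
Proof.
case: x y f ex ey => [x hx] [y hy]; rewrite /elt_val /= => f ex.
case: alpha / ex hx => hx ey; case: beta / ey hy => hy.
rewrite (Prop_irrelevance hx (proj2_sig (orbit_elt afree x))).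
by rewrite (Prop_irrelevance hy (proj2_sig (orbit_elt afree y))).
Qed.

Lemma quotient_proj_epi (F F' : kfunctor (quotient_cat afree) B) :
  kcomp F P = kcomp F' P -> F = F'.
Proof.
move=> FP; apply/kfunctor_eqP.
have e alpha : F alpha = F' alpha.
  rewrite -(quotient_ob_proj (qelt alpha)).
  exact: (congr1 (fun K : kfunctor C B => K (qelt alpha)) FP).
exists e => alpha beta; elim/qhom_ind => [|x y f q IHq].
  by rewrite !(lin0 (@fhom_lin _ _ _ _ _ _)) (lin0 (hcast_linear _ _)).
rewrite !(linD (@fhom_lin _ _ _ _ _ _)) (linD (hcast_linear _ _)) IHq.
congr (_ + _).
rewrite (qcls_proj f (quotient_ob_proj x) (quotient_ob_proj y)) !fhom_hcast.
have eP z : F (P z) = F' (P z) by [].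
have /= <- := @kfunctor_eq_fhom _ _ _ (kcomp F P) (kcomp F' P) x y f
  (eP x) (eP y) FP.
by rewrite !hcast_trans; congr (hcast _ _ _); apply: Prop_irrelevance.
Qed.

Variables (F : kfunctor C B) (Finv : forall g, kcomp F (a g) = F).

Lemma invariant_elt alpha (x y : elt alpha) : F x = F y.
Proof. by have [g <-] := orbit_trans x y; rewrite -[in LHS](Finv g). Qed.

(** The value of the induced functor on the class of f; the equalities move F f
to the representatives of the orbits chosen by [qelt]. *)
Definition lift_gen alpha beta (x : elt alpha) (y : elt beta) (f : hom x y) :
    hom (F (qelt alpha)) (F (qelt beta)) :=
  hcast (invariant_elt x (qelt alpha)) (invariant_elt y (qelt beta)) (fhom F f).

Lemma lift_gen_linear alpha beta (x : elt alpha) (y : elt beta) :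
  linear (@lift_gen _ _ x y).
Proof. by move=> b f g; rewrite /lift_gen fhom_lin hcast_linear. Qed.

Lemma lift_gen_act alpha beta g (x : elt alpha) (y : elt beta) (f : hom x y) :
  lift_gen (x := elt_act g x) (y := elt_act g y) (fhom (a g) f) = lift_gen f.
Proof.
have e z : F z = kcomp F (a g) z by rewrite Finv.
have := @kfunctor_eq_fhom _ _ _ F (kcomp F (a g)) x y f
  (e x) (e y) (esym (Finv g)).
rewrite /lift_gen /= => <-; rewrite hcast_trans.
by congr (hcast _ _ _); apply: Prop_irrelevance.
Qed.

Definition lift_sum alpha beta :
    qsum alpha beta -> hom (F (qelt alpha)) (F (qelt beta)) :=
  dlift (fun (i : elt alpha * elt beta) (f : hom (i.1 : C) (i.2 : C)) =>
    lift_gen f).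

Lemma lift_sum_linear alpha beta : linear (@lift_sum alpha beta).
Proof. by apply: dlift_linear => i; apply: lift_gen_linear. Qed.

Lemma lift_sum_inj alpha beta (x : elt alpha) (y : elt beta) (f : hom x y) :
  lift_sum (qsum_inj f) = lift_gen f.
Proof.
by rewrite /lift_sum /qsum_inj dlift_inj // => i; apply: lift_gen_linear.
Qed.

Lemma lift_sum_act alpha beta g (u : qsum alpha beta) :
  lift_sum (qsum_act g u) = lift_sum u.
Proof.
elim/dsum_ind: u => [|[x y] f u IHu].
  by rewrite (lin0 (qsum_act_linear _)).
rewrite (linD (qsum_act_linear _)) !(linD (@lift_sum_linear _ _)) IHu.
by rewrite -[dinj _ _]/(qsum_inj f) qsum_act_inj !lift_sum_inj lift_gen_act.
Qed.

Definition lift_hom alpha beta (q : qhom alpha beta) :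
    hom (F (qelt alpha)) (F (qelt beta)) :=
  lift_sum (sval (cid (coinv_pi_surj q))).

Lemma lift_hom_qpr alpha beta (u : qsum alpha beta) :
  lift_hom (qpr u) = lift_sum u.
Proof.
rewrite /lift_hom; case: cid => v /= /coinv_piP vu.
have := aug_sub_kill (@lift_sum_linear alpha beta) (@lift_sum_act alpha beta) vu.
by rewrite addrC -scaleN1r lift_sum_linear scaleN1r addrC => /subr0_eq.
Qed.

Lemma lift_hom_linear alpha beta : linear (@lift_hom alpha beta).
Proof.
move=> b p q; have [u <-] : exists u, qpr u = p := coinv_pi_surj p.
have [v <-] : exists v, qpr v = q := coinv_pi_surj q.
by rewrite -qpr_linear !lift_hom_qpr lift_sum_linear.
Qed.

Lemma lift_hom_cls alpha beta (x : elt alpha) (y : elt beta) (f : hom x y) :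
  lift_hom (qcls f) = lift_gen f.
Proof. by rewrite /qcls lift_hom_qpr lift_sum_inj. Qed.

Lemma lift_hom_comp alpha beta gamma (q : qhom beta gamma) (p : qhom alpha beta) :
  lift_hom (qcomp q p) = Defs.comp (lift_hom q) (lift_hom p).
Proof.
elim/qhom_ind: p => [|x y f p IHp].
  rewrite (lin0 (qcomp_linr afree q)) !(lin0 (@lift_hom_linear _ _)).
  by rewrite (lin0 (comp_linr _)).
rewrite (linD (qcomp_linr afree q)) !(linD (@lift_hom_linear _ _)).
rewrite (linD (comp_linr _)) IHp.
congr (_ + _); elim/qhom_ind: q {p IHp} => [|y' z g q IHq].
  rewrite (lin0 (qcomp_linl afree _)) !(lin0 (@lift_hom_linear _ _)).
  by rewrite (lin0 (comp_linl _)).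
rewrite (linD (qcomp_linl afree _)) !(linD (@lift_hom_linear _ _)).
rewrite (linD (comp_linl _)) IHq.
(* The second class is represented by a morphism composable with f. *)
congr (_ + _); have [z1 [g1 <-]] := qcls_align y g.
by rewrite (qcomp_cls afree) !lift_hom_cls /lift_gen fhom_comp -hcast_comp.
Qed.

Lemma lift_hom_id alpha : lift_hom (qid alpha) = idm (F (qelt alpha)).
Proof. by rewrite lift_hom_cls /lift_gen hcast_id fhom_id. Qed.

Definition quotient_lift : kfunctor (quotient_cat afree) B :=
  @KFunctor k (quotient_cat afree) B (fun alpha => F (qelt alpha)) lift_hom
    lift_hom_linear lift_hom_id (fun _ _ _ => @lift_hom_comp _ _ _).

Lemma quotient_lift_proj : kcomp quotient_lift P = F.
Proof.
apply/kfunctor_eqP; exists (fun x => invariant_elt (qelt _) (orbit_elt afree x)).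
by move=> x y f /=; rewrite lift_hom_cls /lift_gen hcast_trans hcast_id.
Qed.

End QuotientUniversal.

(** * Isomorphisms and Galois coverings *)

Section Isomorphisms.
Variable k : comPzRingType.
Implicit Types B C D : kcat k.

Lemma kiso_bij C D (F : kfunctor C D) :
  (forall d, exists c, F c = d) -> injective F ->
  (forall x y, bijective (@fhom _ _ _ F x y)) -> is_kiso F.
Proof.
move=> Fsurj Finj Fbij.
pose g d := sval (cid (Fsurj d)).
have gK d : F (g d) = d := svalP (cid (Fsurj d)).
have inv_ex x y : exists h : hom (F x) (F y) -> hom x y,
    cancel (@fhom _ _ _ F x y) h /\ cancel h (@fhom _ _ _ F x y).
  by have [h hK Kh] := Fbij x y; exists h.
pose h x y := sval (cid (inv_ex x y)).
have hK x y : cancel (@fhom _ _ _ F x y) (@h x y) := (svalP (cid (inv_ex x y))).1.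
have Kh x y : cancel (@h x y) (@fhom _ _ _ F x y) := (svalP (cid (inv_ex x y))).2.
pose G1 d d' (f : hom d d') : hom (g d) (g d') :=
  h _ _ (hcast (esym (gK d)) (esym (gK d')) f).
have G1lin d d' : linear (@G1 d d').
  by move=> a u v; rewrite /G1 hcast_linear (can_linear (@fhom_lin _ _ _ F _ _)).
have G1id d : G1 _ _ (idm d) = idm (g d).
  by rewrite /G1 hcast_idm -fhom_id hK.
have G1comp d1 d2 d3 (v : hom d2 d3) (u : hom d1 d2) :
    G1 _ _ (Defs.comp v u) = Defs.comp (G1 _ _ v) (G1 _ _ u).
  apply: (can_inj (@hK _ _)); rewrite fhom_comp !Kh.
  exact: hcast_comp.
exists (KFunctor G1lin G1id G1comp); split; apply/kfunctor_eqP.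
  exists (fun x => Finj _ _ (gK (F x))) => x y f /=.
  apply: (can_inj (@hK _ _)); rewrite fhom_hcast /G1 Kh hcast_trans.
  exact: hcast_id.
by exists gK => d d' f /=; rewrite /G1 Kh hcast_trans hcast_id.
Qed.

Lemma star_map_comp C D B (G : kfunctor D B) (F : kfunctor C D) (x : C) :
  star_map (kcomp G F) (x := x) =1 star_map G (x := F x) \o star_map F (x := x).
Proof.
move=> [u v]; congr pair.
  apply: (dlift_ext _ (f := fun u => (star_map G (star_map F (x := x) (u, 0))).1)).
  - exact: (@fhom_out_linear _ _ _ (kcomp G F) x).
  - move=> a p q /=; rewrite !(dlift_linear (@fhom_out_linear _ _ _ F x)).
    exact: (dlift_linear (@fhom_out_linear _ _ _ G (F x))).
  move=> y f /=; rewrite (dlift_inj (@fhom_out_linear _ _ _ F x)).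
  exact: (dlift_inj (@fhom_out_linear _ _ _ G (F x))).
apply: (dlift_ext _ (f := fun v => (star_map G (star_map F (x := x) (0, v))).2)).
- exact: (@fhom_in_linear _ _ _ (kcomp G F) x).
- move=> a p q /=; rewrite !(dlift_linear (@fhom_in_linear _ _ _ F x)).
  exact: (dlift_linear (@fhom_in_linear _ _ _ G (F x))).
move=> y f /=; rewrite (dlift_inj (@fhom_in_linear _ _ _ F x)).
exact: (dlift_inj (@fhom_in_linear _ _ _ G (F x))).
Qed.

Lemma star_map_kid C (F : kfunctor C C) (x : C) :
  F = kid C -> bijective (star_map F (x := x)).
Proof.
move=> ->; apply: (eq_bij (f := id)) => [|[u v]]; first by exists id.
congr pair; apply/esym.
  by apply: (dlift_ext (@fhom_out_linear _ _ _ (kid C) x) (f := id)).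
by apply: (dlift_ext (@fhom_in_linear _ _ _ (kid C) x) (f := id)).
Qed.

(** With K' inverse to K, the star maps of K'K and of KK' are bijective.  The
first fact makes the star map of K injective with a left inverse, the second
makes the star map of K' injective, which turns that left inverse into a right
inverse. *)
Lemma star_map_kiso C D (K : kfunctor C D) (x : C) :
  is_kiso K -> bijective (star_map K (x := x)).
Proof.
move=> [K' [K'K KK']].
have [h hK Kh] := eq_bij (star_map_kid x K'K) (@star_map_comp _ _ _ K' K x).
have [h' hK' _] :=
  eq_bij (star_map_kid (K x) KK') (@star_map_comp _ _ _ K K' (K x)).
exists (fun w => h (star_map K' w)) => [u|w]; first exact: (hK u).
apply: (inj_compr (can_inj hK')); exact: (Kh (star_map K' w)).
Qed.

Lemma galois_kiso_comp C B D (K : kfunctor B D) (F : kfunctor C B) :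
  is_kiso K -> is_galois F -> is_galois (kcomp K F).
Proof.
move=> Kiso [Fcov Cconn [b Tb]]; have [K' [K'K KK']] := Kiso.
have Kinj : injective K.
  apply: (can_inj (g := K')) => c.
  by rewrite -[LHS]/(kcomp K' K c) K'K.
split=> //.
  split=> [d|x].
    have [x xd] := Fcov.1 (K' d); exists x; rewrite /= xd.
    by rewrite -[LHS]/(kcomp K K' d) KK'.
  apply: eq_bij (fsym (@star_map_comp _ _ _ K F x)).
  exact: bij_comp (star_map_kiso _ Kiso) (Fcov.2 x).
exists (K b) => x y /Kinj xb /Kinj yb; have [H Hxy] := Tb x y xb yb.
have KH : val H \in aut1_pred (kcomp K F).
  by apply/asboolP; rewrite -kcompA (aut1_comp H).
by exists (exist _ (val H) KH).
Qed.

End Isomorphisms.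

(** * The quotient of a covering by a group transitive on its fibres *)

Section QuotientOfCovering.
Variables (k : comPzRingType) (C B : kcat k) (G : groupType).
Variables (a : UMagmaMorphism.type G (kaut C)) (afree : act_free a).
Variables (F : kfunctor C B) (Finv : forall g, kcomp F (a g) = F).
Hypothesis Fcov : is_covering F.
Hypothesis Ftrans : forall x y, F x = F y -> exists g, a g x = y.
Local Coercion elt_val : elt >-> ob.

(** The inverse splits a morphism of B along the covering, with source lifted to
the representative x of alpha, and sends the component x -> y to its class: the
object y lies in the orbit beta because it lies in the fibre of beta. *)
Lemma quotient_lift_fhom_bij (alpha beta : quotient_cat afree) :
  bijective (@fhom _ _ _ (quotient_lift afree Finv) alpha beta).
Proof.
have in_beta y : F y = F (qelt beta) -> sval beta y.
  move=> /esym/Ftrans[g <-]; exact/orbit_act/(svalP (qelt beta)).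
pose phi y (e : F y = F (qelt beta)) (f : hom (qelt alpha : C) y) :
    qhom alpha beta :=
  qcls (x := qelt alpha) (y := exist _ y (in_beta y e)) f.
have phi_lin y e : linear (@phi y e).
  exact: (@qcls_linear _ _ _ _ alpha beta
    (qelt alpha) (exist _ y (in_beta y e))).
have [L Llin LF] := covering_out_lift Fcov phi_lin.
have lift_lin : linear (lift_hom Finv (alpha := alpha) (beta := beta)).
  exact: lift_hom_linear.
have LK : cancel (lift_hom Finv (alpha := alpha) (beta := beta)) L.
  elim/qhom_ind => [|x y f q IHq].
    by rewrite (lin0 lift_lin) (lin0 Llin).
  rewrite (linD lift_lin) (linD Llin) IHq; congr (_ + _).
  have [z [h <-]] := qcls_align (qelt alpha) f.
  rewrite lift_hom_cls /lift_gen.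
  rewrite (Prop_irrelevance (invariant_elt Finv (qelt alpha) _) erefl) LF /phi.
  by case: z h => z hz h; rewrite (Prop_irrelevance (in_beta _ _) hz).
exists L => // g.
apply: (covering_out_ind Fcov (x := qelt alpha) (eb := erefl)
  (P := fun g => lift_hom Finv (L g) = g)) => [|u v Lu Lv|y e f].
- by rewrite (lin0 Llin) (lin0 lift_lin).
- by rewrite (linD Llin) (linD lift_lin) Lu Lv.
rewrite LF lift_hom_cls /lift_gen.
by congr (hcast _ _ _); apply: Prop_irrelevance.
Qed.

Lemma quotient_lift_kiso : is_kiso (quotient_lift afree Finv).
Proof.
apply: kiso_bij => [b|alpha beta|]; last exact: quotient_lift_fhom_bij.
  have [x <-] := Fcov.1 b; exists (quotient_proj afree x).
  exact: (congr1 (fun K : kfunctor C B => K x) (quotient_lift_proj afree Finv)).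
move=> /Ftrans[g eg]; rewrite -(quotient_ob_proj afree (qelt alpha)).
by rewrite -(quotient_proj_act afree g) eg (quotient_ob_proj afree (qelt beta)).
Qed.

End QuotientOfCovering.

Theorem theorem3p7 (k : comPzRingType) (C B : kcat k) (F : kfunctor C B)
    (FGal : is_galois F) :
  let CG : kcat k := quotient_cat (galois_free FGal) in
  let P : kfunctor C CG := quotient_proj (galois_free FGal) in
  is_galois P /\
  exists! F' : kfunctor CG B, is_kiso F' /\ kcomp F' P = F.
Proof.
move=> CG P; have [Fcov _ _] := FGal.
have Ftrans x y : F x = F y -> exists g : aut1 F, aut1_action F g x = y.
  by move=> xy; apply: (galois_fibre_transitive (b := F y) FGal).
pose F' : kfunctor CG B := quotient_lift (galois_free FGal) (@aut1_comp _ _ _ F).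
have F'iso : is_kiso F' := quotient_lift_kiso _ _ Fcov Ftrans.
have F'P : kcomp F' P = F := quotient_lift_proj _ _.
split; last first.
  exists F'; split=> // F'' [_ F''P].
  by apply: (quotient_proj_epi (afree := galois_free FGal)); rewrite -/P F'P.
have [F1 [F1F' F'F1]] := F'iso.
have -> : P = kcomp F1 F by rewrite -F'P kcompA F1F' kcomp1f.
by apply: galois_kiso_comp => //; exists F'.
Qed.
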